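(* Let $0<a<b$ be real numbers, let $s\in(0,1]$, and let $q>1$. Then $$\left|L_s^s(a,b)+\frac{(s-1)G^2(a,b)L_{s-2}^{s-2}(a,b)-A^s(a,b)}{2}\right|$$ $$\le \frac{A^{1-\frac1q}(a,b)}{\left(2^{2q+s}(s+1)(s+2)\right)^{1/q}}\Big\{\left[(as+a+b)\left(sb^{s-1}\right)^q+\left(b\left(s2^{s+1}+1\right)+a\left(2^{s+2}-s-3\right)\right)\left(sa^{s-1}\right)^q\right]^{1/q}$$ $$+\left[(bs+b+a)\left(sa^{s-1}\right)^q+\left(a\left(s2^{s+1}+1\right)+b\left(2^{s+2}-s-3\right)\right)\left(sb^{s-1}\right)^q\right]^{1/q}\Big\},$$ where for $s=1$ the term $(s-1)G^2(a,b)L_{s-2}^{s-2}(a,b)$ is read as $0$.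
   Context: For $0<u<v$: $A(u,v)=\frac{u+v}{2}$ (arithmetic mean), $G(u,v)=\sqrt{uv}$ (geometric mean), and for real $p\neq -1,0$, $L_p(u,v)=\left(\frac{v^{p+1}-u^{p+1}}{(p+1)(v-u)}\right)^{1/p}$ (generalized logarithmic mean). Exponents on means denote powers of their values: $A^r(u,v)=(A(u,v))^r$, $G^2(u,v)=(G(u,v))^2=uv$, and $L_p^p(u,v)=(L_p(u,v))^p=\frac{v^{p+1}-u^{p+1}}{(p+1)(v-u)}$. *)

(* Defs.v *)
From Stdlib Require Import Reals.
Local Open Scope R_scope.

(* Means of two positive reals u < v.  Real exponents are rendered by
   [Rpower x y = exp (y * ln x)]; every base below is positive in that range
   (for the base in [Lmean] this holds for p + 1 of either sign). *)

Definition Amean (u v : R) : R := (u + v) / 2.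

Definition Gmean (u v : R) : R := sqrt (u * v).

(* Generalized logarithmic mean, meaningful for p <> -1 and p <> 0.  Division
   being total, [Lmean (-1) u v] is an unspecified real number, so a product
   0 * Rpower (Lmean (-1) u v) r is 0. *)
Definition Lmean (p u v : R) : R :=
  Rpower ((Rpower v (p + 1) - Rpower u (p + 1)) / ((p + 1) * (v - u))) (1 / p).

(* Main.v *)
Require Import Defs.
From Stdlib Require Import Reals Lra.
From Coquelicot Require Import Coquelicot.
Local Open Scope R_scope.

(** With [f x = x ^ s], integration by parts turns the quantity inside the
    absolute value into [(J a b + J b a) / 4], where
    [J u v] is the integral over [0, 1] of [w t * f' (x t)], with the weight
    [w t = (1 - t) v + t u] and the point [x t = (1 - t/2) u + (t/2) v], which
    runs from [u] to the midpoint ([midpoint_integral], [deviation_split]).  The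
    right-hand side splits in the same way, so it is enough to bound one [J],
    for [u] and [v] in either order.

    The weight has total mass [A = (u + v) / 2], so the power-mean inequality
    gives [J <= A^(1-1/q) * (integral of w * f'^q)^(1/q)].  As [f'^q] is a
    constant times [x ^ (q (s-1))], with a nonpositive exponent, it is convex,
    and therefore [f'^q (x t) <= (1 - t/2) f'^q u + (t/2) f'^q v].  The bound to
    be proved is the one in which the convexity weights [l] are replaced by the
    larger [l ^ s]; once the weights are integrated, this replacement compares
    four explicit coefficients ([far_coefficients], [near_coefficients]). *)

(** * Real powers *)

Lemma Rpower_pos x y : 0 < Rpower x y.
Proof. apply exp_pos. Qed.

Lemma Rpower_root x p : 0 < x -> p <> 0 -> Rpower (Rpower x (1 / p)) p = x.
Proof.
  intros Hx Hp. rewrite Rpower_mult.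
  replace (1 / p * p) with 1 by (field; exact Hp). now apply Rpower_1.
Qed.

Lemma Rpower_succ x y : 0 < x -> Rpower x (y + 1) = Rpower x y * x.
Proof. intros Hx. rewrite Rpower_plus, Rpower_1; [reflexivity | exact Hx]. Qed.

Lemma Rpower_div_base x y p :
  0 < x -> 0 < y -> Rpower (x / y) p = Rpower x p / Rpower y p.
Proof.
  intros Hx Hy. unfold Rpower, Rdiv.
  rewrite ln_mult, ln_Rinv by (try apply Rinv_0_lt_compat; assumption).
  rewrite <- exp_Ropp, <- exp_plus. f_equal. ring.
Qed.

Lemma exp_ge_tangent m z : exp m * (1 + (z - m)) <= exp z.
Proof.
  replace z with (m + (z - m)) at 2 by ring. rewrite exp_plus.
  apply Rmult_le_compat_l; [left; apply exp_pos | apply exp_ineq1_le].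
Qed.

Lemma ln_le_sub1 x : 0 < x -> ln x <= x - 1.
Proof.
  intros Hx. generalize (exp_ineq1_le (ln x)). rewrite exp_ln by exact Hx. lra.
Qed.

(** The tangent at [m] lies below the power because
    [exp (r ln (x/m)) >= 1 + r ln (x/m) >= 1 + r (x/m - 1)]; the sign of [r]
    enters in the second step. *)
Lemma Rpower_neg_ge_tangent r m x :
  r <= 0 -> 0 < m -> 0 < x -> Rpower m r * (1 + r * (x / m - 1)) <= Rpower x r.
Proof.
  intros Hr Hm Hx.
  assert (Hxm : 0 < x / m) by (apply Rdiv_lt_0_compat; assumption).
  replace x with (m * (x / m)) at 2 by (field; lra).
  rewrite <- Rpower_mult_distr by assumption.
  apply Rmult_le_compat_l; [left; apply Rpower_pos |].
  apply Rle_trans with (2 := exp_ineq1_le _).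
  generalize (ln_le_sub1 (x / m) Hxm). nra.
Qed.

Lemma Rpower_neg_convex r x y l :
  r <= 0 -> 0 < x -> 0 < y -> 0 <= l <= 1 ->
  Rpower ((1 - l) * x + l * y) r <= (1 - l) * Rpower x r + l * Rpower y r.
Proof.
  intros Hr Hx Hy Hl.
  set (m := (1 - l) * x + l * y).
  assert (Hm : 0 < m) by (unfold m; nra).
  apply Rle_trans with
    ((1 - l) * (Rpower m r * (1 + r * (x / m - 1)))
     + l * (Rpower m r * (1 + r * (y / m - 1)))).
  - right. transitivity (Rpower m r * (1 + r * (((1 - l) * x + l * y) / m - 1)));
      [fold m | ]; field; lra.
  - apply Rplus_le_compat; apply Rmult_le_compat_l; try lra;
      now apply Rpower_neg_ge_tangent.
Qed.

(** Bernoulli's inequality for exponents in [0, 1]: the weighted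
    arithmetic-geometric mean of 1 and [t], with weights [1 - p] and [p], which
    is the tangent of [exp] at [p ln t] evaluated at 0 and at [ln t]. *)
Lemma Rpower_le_tangent p t :
  0 <= p <= 1 -> 0 < t -> Rpower t p <= 1 + p * (t - 1).
Proof.
  intros Hp Ht.
  generalize (exp_ge_tangent (p * ln t) 0), (exp_ge_tangent (p * ln t) (ln t)).
  fold (Rpower t p). rewrite exp_0, exp_ln by exact Ht.
  generalize (Rpower t p) (ln t). intros P l H0 H1. nra.
Qed.

(** Young's inequality, i.e. the tangent at [c] of the concave function
    [z ^ (1/q)], for [z = y ^ q]. *)
Lemma young_tangent q c y :
  1 < q -> 0 < c -> 0 < y ->
  y <= Rpower c (1 / q) * (1 + 1 / q * (Rpower y q / c - 1)).
Proof.
  intros Hq Hc Hy.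
  assert (Hz := Rpower_pos y q).
  replace y with (Rpower c (1 / q) * Rpower (Rpower y q / c) (1 / q)) at 1.
  - apply Rmult_le_compat_l; [left; apply Rpower_pos |].
    apply Rpower_le_tangent; [| now apply Rdiv_lt_0_compat].
    split; [left; apply Rdiv_lt_0_compat; lra |].
    apply Rmult_le_reg_r with q; [lra |].
    replace (1 / q * q) with 1 by (field; lra). lra.
  - rewrite Rpower_mult_distr by (try apply Rdiv_lt_0_compat; assumption).
    replace (c * (Rpower y q / c)) with (Rpower y q) by (field; lra).
    rewrite Rpower_mult. replace (q * (1 / q)) with 1 by (field; lra).
    now apply Rpower_1.
Qed.

(** * Power-mean inequality *)

(** With [g ^ q] itself in place of its majorant [k] this is the usual power-mean
    inequality; the majorant lets the right-hand side be an integral with an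
    elementary value.  The tangent of [z ^ (1/q)] at the mean [K / W] of [k]
    bounds [g] pointwise by an affine function of [k], whose non-constant part
    has weighted integral zero. *)
Lemma power_mean_inequality (w g k : R -> R) (q x y W I K : R) :
  1 < q -> x <= y -> 0 < W -> 0 < K ->
  is_RInt w x y W ->
  is_RInt (fun t => w t * g t) x y I ->
  is_RInt (fun t => w t * k t) x y K ->
  (forall t, x < t < y -> 0 <= w t /\ 0 < g t /\ Rpower (g t) q <= k t) ->
  I <= Rpower W (1 - 1 / q) * Rpower K (1 / q).
Proof.
  intros Hq Hxy HW HK Iw Ig Ik H.
  set (c := K / W). assert (Hc : 0 < c) by now apply Rdiv_lt_0_compat.
  set (G := Rpower c (1 / q)).
  assert (HG : 0 < G) by apply Rpower_pos.
  assert (Hbound : is_RInt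
     (fun t => plus (scal (G * (1 - 1 / q)) (w t)) (scal (G * (1 / q / c)) (w t * k t)))
     x y (plus (scal (G * (1 - 1 / q)) W) (scal (G * (1 / q / c)) K))).
  { apply @is_RInt_plus; now apply @is_RInt_scal. }
  assert (HI := is_RInt_le _ _ _ _ _ _ Hxy Ig Hbound).
  replace (Rpower W (1 - 1 / q) * Rpower K (1 / q)) with (G * W).
  - replace (G * W) with (plus (scal (G * (1 - 1 / q)) W) (scal (G * (1 / q / c)) K)).
    + apply HI. intros t Ht. destruct (H t Ht) as (Hw & Hg & Hk).
      assert (Hy := young_tangent q c (g t) Hq Hc Hg). fold G in Hy.
      unfold plus, scal; simpl; unfold mult; simpl.
      replace (G * (1 - 1 / q) * w t + G * (1 / q / c) * (w t * k t))
        with (w t * (G * (1 + 1 / q * (k t / c - 1)))) by (field; lra).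
      apply Rmult_le_compat_l; [exact Hw |].
      apply Rle_trans with (1 := Hy).
      apply Rmult_le_compat_l; [lra |].
      apply Rplus_le_compat_l, Rmult_le_compat_l.
      * left; apply Rdiv_lt_0_compat; lra.
      * apply Rplus_le_compat_r. unfold Rdiv. apply Rmult_le_compat_r; [|exact Hk].
        left; now apply Rinv_0_lt_compat.
    + unfold plus, scal; simpl; unfold mult; simpl. unfold c. field. lra.
  - unfold G, c. rewrite Rpower_div_base by assumption.
    unfold Rminus. rewrite Rpower_plus, Rpower_Ropp, Rpower_1 by exact HW.
    field. apply Rgt_not_eq, Rpower_pos.
Qed.

(** * The weighted integral over half of the interval *)

Definition weight (u v t : R) : R := (1 - t) * v + t * u.

Definition half_point (u v t : R) : R := (1 - t / 2) * u + t / 2 * v.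

Lemma half_point_pos u v t : 0 < u -> 0 < v -> 0 <= t <= 1 -> 0 < half_point u v t.
Proof. unfold half_point; intros; nra. Qed.

Lemma is_RInt_weight u v : is_RInt (weight u v) 0 1 (Amean u v).
Proof.
  set (F := fun t => t * v + t ^ 2 / 2 * (u - v)).
  replace (Amean u v) with (minus (F 1) (F 0))
    by (unfold minus, plus, opp, F, Amean; simpl; field).
  apply @is_RInt_derive; intros t _.
  - unfold F. auto_derive; [exact I | unfold weight; field].
  - apply @ex_derive_continuous. unfold weight. auto_derive. exact I.
Qed.

Lemma is_RInt_weight_linear u v P Q :
  is_RInt (fun t => weight u v t * ((1 - t / 2) * P + t / 2 * Q)) 0 1
    ((5 * v + 4 * u) / 12 * P + (2 * u + v) / 12 * Q).
Proof.
  set (F := fun t => v * P * t + ((u - v) * P + v * (Q - P) / 2) * t ^ 2 / 2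
                     + (u - v) * (Q - P) / 2 * t ^ 3 / 3).
  replace ((5 * v + 4 * u) / 12 * P + (2 * u + v) / 12 * Q) with (minus (F 1) (F 0))
    by (unfold minus, plus, opp, F; simpl; field).
  apply @is_RInt_derive; intros t _.
  - unfold F. auto_derive; [exact I | unfold weight; field].
  - apply @ex_derive_continuous. unfold weight. auto_derive. exact I.
Qed.

(** Integration by parts: with [f x = x ^ s] and [F' = f], the primitive is
    [w f / d + 2 F / d], where [d] is the slope of [half_point] and [-2 d] that of
    the weight. *)
Lemma midpoint_integral s u v :
  0 < u -> 0 < v -> u <> v -> 0 < s ->
  is_RInt (fun t => weight u v t * (s * Rpower (half_point u v t) (s - 1))) 0 1
    ((u * Rpower (Amean u v) s - v * Rpower u s
      + 2 * (Rpower (Amean u v) (s + 1) - Rpower u (s + 1)) / (s + 1))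
     / ((v - u) / 2)).
Proof.
  intros Hu Hv Huv Hs.
  set (d := (v - u) / 2). assert (Hd : d <> 0) by (unfold d; lra).
  set (F := fun t => weight u v t * Rpower (half_point u v t) s / d
                     + 2 * Rpower (half_point u v t) (s + 1) / ((s + 1) * d)).
  match goal with |- is_RInt _ _ _ ?V => replace V with (minus (F 1) (F 0)) end.
  - apply @is_RInt_derive; intros t Ht;
      rewrite Rmin_left, Rmax_right in Ht by lra;
      assert (Hx := half_point_pos u v t Hu Hv Ht).
    + unfold F, Rpower, weight, half_point.
      unfold half_point in Hx.
      auto_derive; [repeat split; lra |].
      change ((1 + - (t * / 2)) * u + t * / 2 * v)
        with ((1 - t / 2) * u + t / 2 * v).
      set (x := (1 - t / 2) * u + t / 2 * v) in *.
      fold (Rpower x s) (Rpower x (s + 1)) (Rpower x (s - 1)).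
      assert (Hs1 : Rpower x s = Rpower x (s - 1) * x)
        by (rewrite <- Rpower_succ by exact Hx; f_equal; ring).
      rewrite (Rpower_succ x s Hx), Hs1. unfold d. field. lra.
    + apply @ex_derive_continuous. unfold weight, Rpower, half_point.
      unfold half_point in Hx. auto_derive. lra.
  - unfold minus, plus, opp, F; simpl.
    replace (half_point u v 1) with (Amean u v) by (unfold half_point, Amean; field).
    replace (half_point u v 0) with u by (unfold half_point; field).
    unfold weight. field. lra.
Qed.

(** * Comparison of coefficients *)

Lemma Rpower_2_succ x : Rpower 2 (x + 1) = 2 * Rpower 2 x.
Proof. rewrite Rpower_succ; lra. Qed.

(** From [ln (14/15) <= -1/15], since [(14/15)^10 > 1/2]. *)
Lemma ln2_ge : 2 / 3 <= ln 2.
Proof.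
  assert (Hlog := ln_le_sub1 (14 / 15) ltac:(lra)).
  assert (Hpow := ln_increasing (/ 2) ((14 / 15) ^ 10) ltac:(lra) ltac:(lra)).
  rewrite ln_pow, ln_Rinv in Hpow by lra. simpl INR in Hpow. lra.
Qed.

(** Bounds on [2 ^ s] that are exact at [s = 1], as [near_coefficients] becomes
    an equality there. *)
Lemma Rpower_2_bounds s :
  0 < s <= 1 ->
  1 <= Rpower 2 s <= 2 /\ 2 <= Rpower 2 s * (2 - s) /\ Rpower 2 s * (5 - 2 * s) <= 6.
Proof.
  intros Hs.
  assert (Hinv : Rpower (/ 2) s * Rpower 2 s = 1).
  { rewrite Rpower_mult_distr by lra. replace (/ 2 * 2) with 1 by field.
    unfold Rpower. rewrite ln_1, Rmult_0_r. apply exp_0. }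
  assert (Hc := Rpower_pos 2 s).
  (* above [2 ^ (-s)], its chord over [0, 1] *)
  assert (Hchord := Rpower_le_tangent s (/ 2) ltac:(lra) ltac:(lra)).
  (* below [2 ^ (1-s)], a line through its value at [s = 1] that is slightly
     flatter than the tangent, whose slope is [- ln 2] *)
  assert (Htan : Rpower 2 (1 - s) >= 1 + 2 / 3 * (1 - s)).
  { unfold Rpower. generalize (exp_ineq1_le ((1 - s) * ln 2)), ln2_ge. nra. }
  assert (Hsplit : Rpower 2 (1 - s) * Rpower 2 s = 2).
  { rewrite <- Rpower_plus. replace (1 - s + s) with 1 by ring. apply Rpower_1. lra. }
  repeat split; nra.
Qed.

(** The integral over [0, 1] of [weight * (t/2)] is at most that of
    [weight * (t/2)^s], both being given by their closed forms. *)
Lemma far_coefficients s u v :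
  0 < s <= 1 -> 0 < u -> 0 < v ->
  (2 * u + v) / 12 <= (u * s + u + v) / (Rpower 2 s * (s + 1) * (s + 2)).
Proof.
  intros Hs Hu Hv.
  destruct (Rpower_2_bounds s Hs) as ((H1 & H2) & _).
  set (c := Rpower 2 s) in *.
  assert (HD : 0 < c * (s + 1) * (s + 2)) by (repeat apply Rmult_lt_0_compat; lra).
  apply (proj1 (Rle_div_r _ _ _ HD)).
  assert (Hu' : c * (s + 2) <= 6) by nra.
  assert (Hv' : c * (s + 2) * (s + 1) <= 12) by nra.
  assert (u * (s + 1) * (c * (s + 2)) <= u * (s + 1) * 6)
    by (apply Rmult_le_compat_l; nra).
  assert (v * (c * (s + 2) * (s + 1)) <= v * 12)
    by (apply Rmult_le_compat_l; lra).
  lra.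
Qed.

(** The same comparison for [weight * (1 - t/2)] and [weight * (1 - t/2)^s]. *)
Lemma near_coefficients s u v :
  0 < s <= 1 -> 0 < u -> 0 < v ->
  (5 * v + 4 * u) / 12
  <= (v * (s * Rpower 2 (s + 1) + 1) + u * (Rpower 2 (s + 2) - s - 3))
     / (Rpower 2 s * (s + 1) * (s + 2)).
Proof.
  intros Hs Hu Hv.
  destruct (Rpower_2_bounds s Hs) as ((H1 & H2) & H3 & H4).
  replace (s + 2) with (s + 1 + 1) at 1 by ring. rewrite !Rpower_2_succ.
  set (c := Rpower 2 s) in *.
  assert (HD : 0 < c * (s + 1) * (s + 2)) by (repeat apply Rmult_lt_0_compat; lra).
  apply (proj1 (Rle_div_r _ _ _ HD)).
  assert (Hv' : c * (5 * s ^ 2 - 9 * s + 10) <= 12) by nra.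
  assert (Hu' : 3 * (s + 3) <= c * (2 - s) * (5 + s)) by nra.
  apply (Rmult_le_compat_l v) in Hv'; [| lra].
  apply (Rmult_le_compat_l u) in Hu'; [| lra].
  lra.
Qed.

(** * The bound for one half of the interval *)

(** The two weights of the convexity inequality at [half_point] lead to the
    coefficients of [near_coefficients] (endpoint [u]) and of
    [far_coefficients] (endpoint [v]).  Stated for either order of [u] and [v],
    so that it covers both halves of the interval. *)
Lemma half_bound s q u v I :
  0 < u -> 0 < v -> 0 < s <= 1 -> 1 < q ->
  is_RInt (fun t => weight u v t * (s * Rpower (half_point u v t) (s - 1))) 0 1 I ->
  0 <= I / 4
  <= Rpower (Amean u v) (1 - 1 / q)
     / Rpower (Rpower 2 (2 * q + s) * (s + 1) * (s + 2)) (1 / q)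
     * Rpower
         ((u * s + u + v) * Rpower (s * Rpower v (s - 1)) q
          + (v * (s * Rpower 2 (s + 1) + 1) + u * (Rpower 2 (s + 2) - s - 3))
            * Rpower (s * Rpower u (s - 1)) q)
         (1 / q).
Proof.
  intros Hu Hv Hs Hq HI.
  assert (Hw : forall t, 0 < t < 1 -> 0 <= weight u v t)
    by (intros t Ht; unfold weight; nra).
  assert (Hg : forall x, 0 < s * Rpower x (s - 1))
    by (intros x; apply Rmult_lt_0_compat; [lra | apply Rpower_pos]).
  split.
  { apply Rmult_le_pos; [| lra].
    apply (is_RInt_ge_0 _ 0 1 I ltac:(lra) HI).
    intros t Ht. apply Rmult_le_pos; [now apply Hw | left; apply Hg]. }
  set (hu := Rpower (s * Rpower u (s - 1)) q).
  set (hv := Rpower (s * Rpower v (s - 1)) q).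
  assert (Hhu : 0 < hu) by apply Rpower_pos.
  assert (Hhv : 0 < hv) by apply Rpower_pos.
  assert (Hgq : forall x, Rpower (s * Rpower x (s - 1)) q
                          = Rpower s q * Rpower x ((s - 1) * q)).
  { intros x. rewrite <- Rpower_mult_distr by (apply Rpower_pos || lra).
    now rewrite Rpower_mult. }
  set (K := (5 * v + 4 * u) / 12 * hu + (2 * u + v) / 12 * hv).
  assert (HK : 0 < K)
    by (apply Rplus_lt_0_compat; apply Rmult_lt_0_compat; lra).
  assert (HA : 0 < Amean u v) by (unfold Amean; lra).
  assert (Hmean : I <= Rpower (Amean u v) (1 - 1 / q) * Rpower K (1 / q)).
  { apply (power_mean_inequality (weight u v)
             (fun t => s * Rpower (half_point u v t) (s - 1))
             (fun t => (1 - t / 2) * hu + t / 2 * hv) q 0 1); try assumption; try lra.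
    - apply is_RInt_weight.
    - apply is_RInt_weight_linear.
    - intros t Ht. split; [now apply Hw | split; [apply Hg |]].
      unfold hu, hv. rewrite !Hgq.
      assert (Hconv := Rpower_neg_convex ((s - 1) * q) u v (t / 2)
                         ltac:(nra) Hu Hv ltac:(lra)).
      apply (Rmult_le_compat_l (Rpower s q)) in Hconv; [| left; apply Rpower_pos].
      unfold half_point. lra. }
  set (E := (u * s + u + v) * hv
            + (v * (s * Rpower 2 (s + 1) + 1) + u * (Rpower 2 (s + 2) - s - 3)) * hu).
  set (D := Rpower 2 s * (s + 1) * (s + 2)).
  assert (HD : 0 < D)
    by (unfold D; repeat apply Rmult_lt_0_compat; try lra; apply Rpower_pos).
  assert (HKE : K <= E / D).
  { assert (Hfar := far_coefficients s u v Hs Hu Hv).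
    assert (Hnear := near_coefficients s u v Hs Hu Hv).
    apply (Rmult_le_compat_r hv) in Hfar; [| lra].
    apply (Rmult_le_compat_r hu) in Hnear; [| lra].
    fold D in Hfar, Hnear. unfold K, E. lra. }
  assert (HE : 0 < E).
  { replace E with (E / D * D) by (field; lra). apply Rmult_lt_0_compat; lra. }
  (* the factor 1/4 is absorbed into the root, since [4 ^ q = 2 ^ (2 q)] *)
  assert (Hroot : Rpower (Rpower 2 (2 * q + s) * (s + 1) * (s + 2)) (1 / q)
                  = 4 * Rpower D (1 / q)).
  { rewrite Rpower_plus. rewrite !(Rmult_assoc (Rpower 2 (2 * q))).
    fold D. rewrite <- Rpower_mult_distr by (apply Rpower_pos || exact HD).
    rewrite Rpower_mult. replace (2 * q * (1 / q)) with (1 + 1) by (field; lra).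
    rewrite Rpower_2_succ, Rpower_1 by lra. ring. }
  rewrite Hroot.
  replace (Rpower (Amean u v) (1 - 1 / q) / (4 * Rpower D (1 / q)) * Rpower E (1 / q))
    with (Rpower (Amean u v) (1 - 1 / q) * Rpower (E / D) (1 / q) / 4)
    by (rewrite Rpower_div_base by assumption; field; apply Rgt_not_eq, Rpower_pos).
  apply Rmult_le_compat_r; [lra |].
  apply Rle_trans with (1 := Hmean).
  apply Rmult_le_compat_l; [left; apply Rpower_pos |].
  apply Rle_Rpower_l; [| lra].
  left; apply Rdiv_lt_0_compat; lra.
Qed.

(** * Reduction to the two halves *)

Lemma Lmean_pow p u v :
  p <> -1 -> p <> 0 -> 0 < u < v ->
  Rpower (Lmean p u v) p
  = (Rpower v (p + 1) - Rpower u (p + 1)) / ((p + 1) * (v - u)).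
Proof.
  intros Hp1 Hp0 Huv. unfold Lmean. apply Rpower_root; [| exact Hp0].
  set (r := p + 1). assert (Hr : r <> 0) by (unfold r; lra).
  assert (Hln : ln u < ln v) by (apply ln_increasing; lra).
  destruct (Rdichotomy r 0 Hr) as [Hneg | Hpos].
  - assert (Rpower v r < Rpower u r) by (apply exp_increasing; nra).
    replace ((Rpower v r - Rpower u r) / (r * (v - u)))
      with ((Rpower u r - Rpower v r) / (- r * (v - u))) by (field; lra).
    apply Rdiv_lt_0_compat; [lra | apply Rmult_lt_0_compat; lra].
  - assert (Rpower u r < Rpower v r) by (apply exp_increasing; nra).
    apply Rdiv_lt_0_compat; [lra | apply Rmult_lt_0_compat; lra].
Qed.

(** For [s = 1] the left-hand side vanishes through its first factor, and so does
    the right-hand side, which therefore extends the formula to that case. *)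
Lemma Gmean_Lmean_term s a b :
  0 < a < b -> 0 < s <= 1 ->
  (s - 1) * Gmean a b ^ 2 * Rpower (Lmean (s - 2) a b) (s - 2)
  = (a * Rpower b s - b * Rpower a s) / (b - a).
Proof.
  intros Hab Hs. destruct (Req_dec s 1) as [-> | Hs1].
  - rewrite !Rpower_1 by lra. field. lra.
  - rewrite Lmean_pow by lra.
    unfold Gmean. rewrite pow2_sqrt by nra.
    replace (s - 2 + 1) with (s - 1) by ring.
    assert (Hpow : forall x, 0 < x -> Rpower x s = Rpower x (s - 1) * x)
      by (intros x Hx; rewrite <- Rpower_succ by exact Hx; f_equal; ring).
    rewrite (Hpow a), (Hpow b) by lra. field. lra.
Qed.

Lemma Amean_comm u v : Amean u v = Amean v u.
Proof. unfold Amean. field. Qed.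

Lemma deviation_split s a b I J :
  0 < a < b -> 0 < s <= 1 ->
  is_RInt (fun t => weight a b t * (s * Rpower (half_point a b t) (s - 1))) 0 1 I ->
  is_RInt (fun t => weight b a t * (s * Rpower (half_point b a t) (s - 1))) 0 1 J ->
  Rpower (Lmean s a b) s
  + ((s - 1) * Gmean a b ^ 2 * Rpower (Lmean (s - 2) a b) (s - 2)
     - Rpower (Amean a b) s) / 2
  = I / 4 + J / 4.
Proof.
  intros Hab Hs HI HJ.
  rewrite Gmean_Lmean_term, Lmean_pow by lra.
  rewrite <- (is_RInt_unique _ _ _ _ HI), <- (is_RInt_unique _ _ _ _ HJ).
  rewrite (is_RInt_unique _ _ _ _ (midpoint_integral s a b ltac:(lra) ltac:(lra) ltac:(lra) ltac:(lra))).
  rewrite (is_RInt_unique _ _ _ _ (midpoint_integral s b a ltac:(lra) ltac:(lra) ltac:(lra) ltac:(lra))).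
  rewrite (Amean_comm b a).
  rewrite (Rpower_succ (Amean a b) s) by (unfold Amean; lra).
  set (m := Rpower (Amean a b) s). unfold Amean. field. lra.
Qed.

Theorem proposition5 (a b s q : R)
  (ha : 0 < a) (hab : a < b) (hs0 : 0 < s) (hs1 : s <= 1) (hq : 1 < q) :
  Rabs (Rpower (Lmean s a b) s
        + ((s - 1) * Gmean a b ^ 2 * Rpower (Lmean (s - 2) a b) (s - 2)
           - Rpower (Amean a b) s) / 2)
  <= Rpower (Amean a b) (1 - 1 / q)
     / Rpower (Rpower 2 (2 * q + s) * (s + 1) * (s + 2)) (1 / q)
     * (Rpower
          ((a * s + a + b) * Rpower (s * Rpower b (s - 1)) q
           + (b * (s * Rpower 2 (s + 1) + 1) + a * (Rpower 2 (s + 2) - s - 3))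
             * Rpower (s * Rpower a (s - 1)) q)
          (1 / q)
        + Rpower
          ((b * s + b + a) * Rpower (s * Rpower a (s - 1)) q
           + (a * (s * Rpower 2 (s + 1) + 1) + b * (Rpower 2 (s + 2) - s - 3))
             * Rpower (s * Rpower b (s - 1)) q)
          (1 / q)).
Proof.
  assert (Iab := midpoint_integral s a b ltac:(lra) ltac:(lra) ltac:(lra) ltac:(lra)).
  assert (Iba := midpoint_integral s b a ltac:(lra) ltac:(lra) ltac:(lra) ltac:(lra)).
  rewrite (Amean_comm b a) in Iba.
  rewrite (deviation_split s a b _ _ ltac:(lra) ltac:(lra) Iab Iba).
  destruct (half_bound s q a b _ ha ltac:(lra) ltac:(lra) hq Iab) as [Hab0 Hab].
  destruct (half_bound s q b a _ ltac:(lra) ha ltac:(lra) hq Iba) as [Hba0 Hba].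
  rewrite (Amean_comm b a) in Hba.
  rewrite Rabs_pos_eq by lra.
  rewrite Rmult_plus_distr_l. lra.
Qed.
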